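(* Let $(G,o)$ be a Menger algebra of rank $n$ and let $H\subseteq G$ be a subset. The following conditions are equivalent: (a) $H$ is strong. (b) For all $x,y\in G$ and all $t_1,t_2\in T_n(G)$: if $t_1(x)\in H$, $t_1(y)\in H$ and $t_2(y)\in H$, then $t_2(x)\in H$. (c) For all $t_1,t_2\in T_n(G)$: if $\rho^{\circ}_H\langle t_1\rangle\cap\rho^{\circ}_H\langle t_2\rangle\neq\varnothing$, then $\rho^{\circ}_H\langle t_1\rangle=\rho^{\circ}_H\langle t_2\rangle$.
   Context: Let $n$ be a positive integer. A Menger algebra $(G,o)$ of rank $n$ is a nonempty set $G$ with an $(n+1)$-ary operation $o:(f,g_1,\ldots,g_n)\mapsto f[g_1\ldots g_n]$ satisfying the superassociative law $f[g_1\ldots g_n][h_1\ldots h_n]=f[g_1[h_1\ldots h_n]\ldots g_n[h_1\ldots h_n]]$ for all $f,g_i,h_i\in G$. $T_n(G)$ is the smallest set of polynomials in one variable $x$ such that $x\in T_n(G)$ and, whenever $i\in\{1,\ldots,n\}$, $a,b_1,\ldots,b_{i-1},b_{i+1},\ldots,b_n\in G$ and $t\in T_n(G)$, also $a[b_1\ldots b_{i-1}\,t\,b_{i+1}\ldots b_n]\in T_n(G)$. Each $t\in T_n(G)$ is identified with the map $G\to G$, $x\mapsto t(x)$, it defines (an elementary translation). For $H\subseteq G$, $a\in G$, $t\in T_n(G)$ put $\rho_H\langle a\rangle=\{t\in T_n(G)\mid t(a)\in H\}$ and $\rho^{\circ}_H\langle t\rangle=\{a\in G\mid t(a)\in H\}$.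 The subset $H$ is called strong if for all $a,b\in G$, $\rho_H\langle a\rangle\cap\rho_H\langle b\rangle\neq\varnothing$ implies $\rho_H\langle a\rangle=\rho_H\langle b\rangle$. *)

(* Defs.v *)
From mathcomp Require Import all_boot.
From mathcomp Require Import all_classical.

Set Implicit Arguments.
Unset Strict Implicit.
Unset Printing Implicit Defensive.

Local Open Scope classical_set_scope.

(* [menger_op f g] is f[g_1 ... g_n]; the n-tuple g is indexed from 0. *)
Record mengerAlgebra (n : nat) := MengerAlgebra {
  menger_sort :> Type;
  menger_op : menger_sort -> {ffun 'I_n -> menger_sort} -> menger_sort;
  menger_nonempty : inhabited menger_sort;
  menger_superassoc :
    forall (f : menger_sort) (g h : {ffun 'I_n -> menger_sort}),
      menger_op (menger_op f g) h
      = menger_op f [ffun i => menger_op (g i) h] }.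

(* The tuple (b_1, ..., b_(i-1), c, b_(i+1), ..., b_n); the entry [b i] is
   irrelevant. *)
Definition put (n : nat) (G : Type) (b : {ffun 'I_n -> G}) (i : 'I_n) (c : G) :
  {ffun 'I_n -> G} := [ffun j => if j == i then c else b j].

(* T_n(G), with each polynomial identified with the map G -> G it defines. *)
Inductive translations (n : nat) (G : mengerAlgebra n) : set (G -> G) :=
| translations_var : translations (fun x => x)
| translations_op (i : 'I_n) (a : G) (b : {ffun 'I_n -> G}) (t : G -> G) :
    translations t -> translations (fun x => menger_op a (put b i (t x))).
Arguments translations {n} G _.

Section Rho.
Variables (n : nat) (G : mengerAlgebra n) (H : set G).

Definition rho (a : G) : set (G -> G) := [set t | translations G t /\ H (t a)].

Definition rho_circ (t : G -> G) : set G := [set a | H (t a)].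

Definition strong : Prop :=
  forall a b : G, rho a `&` rho b !=set0 -> rho a = rho b.

End Rho.

(* Main.v *)
Require Import Defs.
From mathcomp Require Import all_boot.
From mathcomp Require Import all_classical.

Local Open Scope classical_set_scope.

(** View [H (t a)] as a relation between points [a] and translations [t]. Condition (b) says that it
    is difunctional: three corners of a rectangle force the fourth. Conditions (a) and (c) say this
    of its rows [rho] and of its columns [rho_circ] respectively: two that meet coincide. *)

Theorem theorem2p8 (n : nat) (n_gt0 : (0 < n)%N) (G : mengerAlgebra n)
    (H : set G) :
  [<-> strong H;
       forall (x y : G) (t1 t2 : G -> G),
         translations G t1 -> translations G t2 ->
         H (t1 x) -> H (t1 y) -> H (t2 y) -> H (t2 x);
       forall t1 t2 : G -> G,
         translations G t1 -> translations G t2 ->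
         rho_circ H t1 `&` rho_circ H t2 !=set0 ->
         rho_circ H t1 = rho_circ H t2].
Proof.
tfae.
- move=> sH x y t1 t2 Tt1 Tt2 t1x t1y t2y.
  have rho_xy : rho H x = rho H y by apply: sH; exists t1.
  have : rho H y t2 by [].
  by rewrite -rho_xy => -[].
- move=> Hb t1 t2 Tt1 Tt2 [z [t1z t2z]].
  apply/seteqP; split=> w tw.
  (* The common point [z] supplies two corners and [w] the third; swapping [t1] and [t2] gives the
     other inclusion. *)
  + exact: (Hb w z t1 t2).
  + exact: (Hb w z t2 t1).
- move=> Hc.
  have rho_sub a b t : rho H a t -> rho H b t -> rho H a `<=` rho H b.
    move=> [Tt ta] [_ tb] s [Ts sa]; split=> //.
    (* The columns of [s] and [t] meet at [a], and [b] lies in that of [t]. *)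
    have st : rho_circ H s = rho_circ H t by apply: Hc => //; exists a.
    by change (rho_circ H s b); rewrite st.
  move=> a b [t [ta tb]].
  by apply/seteqP; split; [exact: rho_sub ta tb | exact: rho_sub tb ta].
Qed.
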